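(* Let $(G,\cdot)$ and $(H,\circ)$ be two distinct loops that are isotopic under the triple $(A,B,C)$, i.e. $A,B,C:G\to H$ are bijections with $xA\circ yB=(x\cdot y)C$ for all $x,y\in G$. 1. If the pair $(G,\cdot)$, $(H,\circ)$ obeys the $\mathcal{T}$ condition, then $(G,\cdot)$ is a WIPL if and only if $(H,\circ)$ is a WIPL. 2. If $(G,\cdot)$ and $(H,\circ)$ are WIPLs, then $$J_\lambda R_xJ_\rho B=CJ_\lambda' R_{xA}'J_\rho'\quad\text{and}\quad J_\rho L_xJ_\lambda A=CJ_\rho' L_{xB}'J_\lambda'\quad\text{for all }x\in G.$$
   Context: Maps are written on the right of their arguments and composed from left to right: $xAB=(xA)B$. A loop is a set with a binary operation for which $a\cdot x=b$ and $y\cdot a=b$ have unique solutions $x,y$ for all $a,b$, and which has a two-sided identity element $e$. For $x$ in a loop, $x^\rho$ and $x^\lambda$ denote the right and left inverses: $xx^\rho=e=x^\lambda x$. A loop is a weak inverse property loop (WIPL) if $xy\cdot z=e$ implies $x\cdot yz=e$ for all $x,y,z$. For $(G,\cdot)$ put $J_\rho:x\mapsto x^\rho$, $J_\lambda:x\mapsto x^\lambda$, $L_x:y\mapsto x\cdot y$, $R_x:y\mapsto y\cdot x$. The primed maps $J_\rho',J_\lambda',L_x',R_x'$ are the corresponding maps for $(H,\circ)$. $\mathcal{T}$ conditions, for the isotopism $(A,B,C)$: $\mathcal{T}_1$ means $A=B$; $\mathcal{T}_2$ means $J_\rho'=C^{-1}J_\rho B=A^{-1}J_\rho C$; $\mathcal{T}_3$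 means $J_\lambda'=C^{-1}J_\lambda A=B^{-1}J_\lambda C$. The $\mathcal{T}$ condition holds if and only if $\mathcal{T}_1$ and $\mathcal{T}_2$ hold, or $\mathcal{T}_1$ and $\mathcal{T}_3$ hold ($\mathcal{T}_2$ and $\mathcal{T}_3$ being equivalent). *)

(* Defs.v *)
From HB Require Import structures.
From mathcomp Require Import all_boot.
From mathcomp Require Import boolp.

Set Implicit Arguments.
Unset Strict Implicit.
Unset Printing Implicit Defensive.

Local Open Scope group_scope.

(* [baseUMagmaType] carries only an operation and a constant 1, and, unlike
   [umagmaType], does not require a choice structure: the carrier of a loop is
   an arbitrary type. *)
HB.mixin Record BaseUMagma_isLoop G of BaseUMagma G := {
  loop_1mul : left_id (1 : G) *%g;
  loop_mul1 : right_id (1 : G) *%g;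
  loop_solr : forall a b : G, exists! x, a * x = b;
  loop_soll : forall a b : G, exists! y, y * a = b
}.

#[short(type="loopType")]
HB.structure Definition Loop := {G of BaseUMagma_isLoop G & BaseUMagma G}.

Definition wipl (G : loopType) : Prop :=
  forall x y z : G, (x * y) * z = 1 -> x * (y * z) = 1.

Section Translations.
Variable G : loopType.

Definition Jrho (x : G) : G := sval (cid (loop_solr x 1)).
Definition Jlambda (x : G) : G := sval (cid (loop_soll x 1)).

Definition Ltr (x : G) : G -> G := fun y => x * y.
Definition Rtr (x : G) : G -> G := fun y => y * x.

Lemma mulg_Jrho (x : G) : x * Jrho x = 1.
Proof. by rewrite /Jrho; case: cid => y []. Qed.

Lemma mulg_Jlambda (x : G) : Jlambda x * x = 1.
Proof. by rewrite /Jlambda; case: cid => y []. Qed.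

End Translations.

Lemma bij_exists_inv (S T : Type) (f : S -> T) :
  bijective f -> exists g : T -> S, cancel f g /\ cancel g f.
Proof. by case=> g fK gK; exists g. Qed.

Definition bij_inv (S T : Type) (f : S -> T) (bf : bijective f) : T -> S :=
  sval (cid (bij_exists_inv bf)).

Lemma bij_invK (S T : Type) (f : S -> T) (bf : bijective f) :
  cancel f (bij_inv bf).
Proof. by rewrite /bij_inv; case: cid => g []. Qed.

Lemma bij_invKV (S T : Type) (f : S -> T) (bf : bijective f) :
  cancel (bij_inv bf) f.
Proof. by rewrite /bij_inv; case: cid => g []. Qed.

Record isotopism (G H : loopType) (A B C : G -> H) : Prop := Isotopism {
  isoA : bijective A;
  isoB : bijective B;
  isoC : bijective C;
  isoM : forall x y : G, A x * B y = C (x * y)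
}.

(* Maps act on the right, so a composite fg (first f, then g) is [f \; g]. *)
Section TConditions.
Variables (G H : loopType) (A B C : G -> H) (iso : isotopism A B C).

Let Ai : H -> G := bij_inv (isoA iso).
Let Bi : H -> G := bij_inv (isoB iso).
Let Ci : H -> G := bij_inv (isoC iso).

Definition T1_cond : Prop := A =1 B.

Definition T2_cond : Prop :=
  @Jrho H =1 (Ci \; @Jrho G \; B) /\ @Jrho H =1 (Ai \; @Jrho G \; C).

Definition T3_cond : Prop :=
  @Jlambda H =1 (Ci \; @Jlambda G \; A) /\
  @Jlambda H =1 (Bi \; @Jlambda G \; C).

Definition T_cond : Prop := (T1_cond /\ T2_cond) \/ (T1_cond /\ T3_cond).

End TConditions.

(* Main.v *)
Require Import Defs.
From mathcomp Require Import all_boot.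

Set Implicit Arguments.
Unset Strict Implicit.
Unset Printing Implicit Defensive.

(** The weak inverse property is equivalent to either of the identities
    [y * (x * y)^rho = x^rho] and [(x * y)^lambda * x = y^lambda]
    ([wiplP_rho], [wiplP_lambda]).

    For the first part, T1 and T2 say that the isotopism transports the two
    sides of the first identity at [x], [y] in [G], through [C], to the two
    sides of the same identity at [A x], [B y] in [H].  As [C] is injective and
    [A], [B] are surjective, the identity holds in [G] if and only if it holds
    in [H].  T1 and T3 transport the second identity in the same way.

    For the second part, the identities say that in a WIPL the maps
    [u |-> (u^lambda * x)^rho] and [u |-> (x * u^rho)^lambda] are left and right
    division of [u] by [x].  Both claimed equations then say that an isotopism
    carries division in [G] to division in [H], which follows from uniqueness
    of quotients in [H]. *)

Section LoopInverses.
Variable G : loopType.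
Implicit Types x y z u : G.
Local Open Scope group_scope.

Lemma loop_mulgI x : injective (fun y => x * y).
Proof.
move=> y z /= eq_xy; case: (loop_solr x (x * z)) => w [_ uniq_w].
by rewrite -(uniq_w y eq_xy) -(uniq_w z erefl).
Qed.

Lemma loop_mulIg x : injective (fun y => y * x).
Proof.
move=> y z /= eq_yx; case: (loop_soll x (z * x)) => w [_ uniq_w].
by rewrite -(uniq_w y eq_yx) -(uniq_w z erefl).
Qed.

Lemma Jrho_unique x y : x * y = 1 -> y = Jrho x.
Proof. by move=> xy1; apply: (@loop_mulgI x); rewrite /= mulg_Jrho. Qed.

Lemma Jlambda_unique x y : x * y = 1 -> x = Jlambda y.
Proof. by move=> xy1; apply: (@loop_mulIg y); rewrite /= mulg_Jlambda. Qed.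

Lemma JlambdaK : cancel (@Jlambda G) (@Jrho G).
Proof. by move=> x; rewrite -(Jrho_unique (mulg_Jlambda x)). Qed.

Lemma JrhoK : cancel (@Jrho G) (@Jlambda G).
Proof. by move=> x; rewrite -(Jlambda_unique (mulg_Jrho x)). Qed.

(** Given [(x * y) * z = 1], the factor [z] can only be [(x * y)^rho], so the
    weak inverse property says that [y * z] is the right inverse of [x]. *)
Lemma wiplP_rho :
  wipl G <-> forall x y, y * Jrho (x * y) = Jrho x.
Proof.
split=> [wG x y | idG x y z xyz1].
  by apply: Jrho_unique; apply: wG; apply: mulg_Jrho.
by rewrite (Jrho_unique xyz1) idG mulg_Jrho.
Qed.

(** The implication defining a WIPL can be reversed, because [z] is determined
    by [x * (y * z) = 1]; this makes the property left-right symmetric. *)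
Lemma wipl_rev x y z : wipl G -> x * (y * z) = 1 -> (x * y) * z = 1.
Proof.
move=> wG xyz1; suff -> : z = Jrho (x * y) by apply: mulg_Jrho.
apply: (@loop_mulgI y); apply: (@loop_mulgI x) => /=.
by rewrite xyz1 wG //; apply: mulg_Jrho.
Qed.

Lemma wiplP_lambda :
  wipl G <-> forall x y, Jlambda (x * y) * x = Jlambda y.
Proof.
split=> [wG x y | idG x y z xyz1].
  by apply: Jlambda_unique; apply: wipl_rev => //; apply: mulg_Jlambda.
(* The hypothesis makes [x * y] the left inverse of [z], as is
   [(y * z)^lambda * y] by the identity at [y], [z]; cancelling [y] identifies
   [x]. *)
have xyE := Jlambda_unique xyz1.
have xE : x = Jlambda (y * z).
  by apply: (@loop_mulIg y); rewrite /= xyE idG.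
by rewrite xE mulg_Jlambda.
Qed.

Lemma wipl_ldiv x u : wipl G -> x * Jrho (Jlambda u * x) = u.
Proof. by move=> /wiplP_rho ->; rewrite JlambdaK. Qed.

Lemma wipl_rdiv x u : wipl G -> Jlambda (x * Jrho u) * x = u.
Proof. by move=> /wiplP_lambda ->; rewrite JrhoK. Qed.

End LoopInverses.

Section Isotopism.
Variables (G H : loopType) (A B C : G -> H) (iso : isotopism A B C).
Local Open Scope group_scope.

Lemma wipl_iso_T2 : T1_cond A B -> T2_cond iso -> wipl G <-> wipl H.
Proof.
move=> AB [JC JA].
have JrhoC u : Jrho (C u) = B (Jrho u) by rewrite JC /= bij_invK.
have JrhoA u : Jrho (A u) = C (Jrho u) by rewrite JA /= bij_invK.
(* T1 lets [B y] act as a left factor, so that the product of images is again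
   the image of a product. *)
have transport x y :
    B y * Jrho (A x * B y) = C (y * Jrho (x * y)).
  by rewrite (isoM iso) JrhoC -AB (isoM iso).
split=> /wiplP_rho idGH; apply/wiplP_rho => x y.
  rewrite -(bij_invKV (isoA iso) x) -(bij_invKV (isoB iso) y).
  by rewrite transport idGH JrhoA.
by apply: (bij_inj (isoC iso)); rewrite -transport idGH JrhoA.
Qed.

Lemma wipl_iso_T3 : T1_cond A B -> T3_cond iso -> wipl G <-> wipl H.
Proof.
move=> AB [JC JB].
have JlambdaC u : Jlambda (C u) = A (Jlambda u) by rewrite JC /= bij_invK.
have JlambdaB u : Jlambda (B u) = C (Jlambda u) by rewrite JB /= bij_invK.
have transport x y :
    Jlambda (A x * B y) * A x = C (Jlambda (x * y) * x).
  by rewrite (isoM iso) JlambdaC (AB x) (isoM iso).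
split=> /wiplP_lambda idGH; apply/wiplP_lambda => x y.
  rewrite -(bij_invKV (isoA iso) x) -(bij_invKV (isoB iso) y).
  by rewrite transport idGH JlambdaB.
by apply: (bij_inj (isoC iso)); rewrite -transport idGH JlambdaB.
Qed.

Hypotheses (wG : wipl G) (wH : wipl H).

Lemma iso_ldiv x u :
  B (Jrho (Jlambda u * x)) = Jrho (Jlambda (C u) * A x).
Proof.
by apply: (@loop_mulgI _ (A x)); rewrite /= (isoM iso) !wipl_ldiv.
Qed.

Lemma iso_rdiv x u :
  A (Jlambda (x * Jrho u)) = Jlambda (B x * Jrho (C u)).
Proof.
by apply: (@loop_mulIg _ (B x)); rewrite /= (isoM iso) !wipl_rdiv.
Qed.

End Isotopism.

Theorem theorem3p1 (G H : loopType) (GH_distinct : G <> H)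
    (A B C : G -> H) (iso : isotopism A B C) :
  (T_cond iso -> (wipl G <-> wipl H)) /\
  (wipl G -> wipl H ->
     (forall x : G,
        (@Jlambda G \; Rtr x \; @Jrho G \; B)
        =1 (C \; @Jlambda H \; Rtr (A x) \; @Jrho H)) /\
     (forall x : G,
        (@Jrho G \; Ltr x \; @Jlambda G \; A)
        =1 (C \; @Jrho H \; Ltr (B x) \; @Jlambda H))).
Proof.
split=> [[[AB T2] | [AB T3]] | wG wH].
- exact: wipl_iso_T2 AB T2.
- exact: wipl_iso_T3 AB T3.
- split=> x u; first exact: (iso_ldiv iso wG wH).
  exact: (iso_rdiv iso wG wH).
Qed.
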